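(* There is a universal constant $K>0$ such that the following holds for every $d\ge2$, with $M=d^2-1$. Suppose $\{\mathcal G_j\}_{j=1}^M=\{\exp(iH_j)\}_{j=1}^M$ is a fixed exponential basis for $\mathrm{SU}(d)$. Define $$\mu=\inf_{\alpha\ne0}\frac{\left\|\sum_{j=1}^M\alpha_jH_j\right\|}{\|\alpha\|_\infty},\qquad \mu_N=\frac{\mu}{h_{\max}},\qquad h_{\max}=\max_j\|H_j\|,$$ where $\alpha=(\alpha_1,\dots,\alpha_M)$ ranges over nonzero vectors in $\mathbb R^M$. For a fixed value of $\varepsilon_0$ with $0<\varepsilon_0\le\delta_0$, let $n$ be a positive integer such that $$n\ge\frac{\pi^2M^2K}{\varepsilon_0\mu_N^2}.$$ Let $U^{(n)}$ be the output of the discrete trotterization algorithm for some input $U\in\mathrm{SU}(d)$ using the basis $\{\mathcal G_j\}_{j=1}^M$ and the integer $n$. If $$h_{\max}\le\frac{\varepsilon_0}{nM},$$ then $\|U^{(n)}-U\|\le\varepsilon_0$.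
   Context: $\|\cdot\|$ is the operator norm. $\mathfrak{su}(d)$ is the real vector space (dimension $d^2-1$) of traceless Hermitian $d\times d$ matrices, with $[X,Y]=i(XY-YX)$. Every $U\in\mathrm{SU}(d)$ can be written as $U=\exp(iH)$ with $H\in\mathfrak{su}(d)$ and $\|H\|\le2\pi$; $\log U$ denotes such an $H$ (equal to the principal logarithm when that is traceless). Exponential basis: $\mathcal G_j=\exp(iH_j)$, together with $\mathcal G_j^\dagger=\exp(-iH_j)$, where $\{H_j\}_{j=1}^M$ is a basis of the real vector space $\mathfrak{su}(d)$ and $H_j=\log\mathcal G_j$. Discrete trotterization algorithm with parameter $n$: on input $U=\exp(iH)$, $H=\log U$, write $H/n=\sum_{j=1}^M\alpha_jH_j$ with $\alpha_j\in\mathbb R$, let $c_j\in\mathbb Z$ be a nearest integer to $\alpha_j$, and output $$U^{(n)}=\left[\prod_{j=1}^M\mathcal G_j^{c_j}\right]^n.$$ $\delta_0$ is a fixed universal constant with $0<\delta_0<\pi$ for which, together with a universal constant $C\ge1$ (both independent of $d$ and of the number of factors $r$), the Baker--Campbell--Hausdorff estimate holds: if $X_1,\dots,X_r\in\mathfrak{su}(d)$ and $\sum_j\|X_j\|\le\delta\le\delta_0$, then $\log\prod_je^{iX_j}=\sum_jX_j+\frac12\sum_{i<j}[X_i,X_j]+R$ with $\|R\|\le C\delta^3$. *)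

(* Defs.v *)
From HB Require Import structures.
From mathcomp Require Import all_boot all_order all_algebra.
From mathcomp Require Import all_classical all_reals all_analysis.
From mathcomp Require Import complex.

Set Implicit Arguments.
Unset Strict Implicit.
Unset Printing Implicit Defensive.

Import Order.TTheory GRing.Theory Num.Theory.
Import numFieldNormedType.Exports.

Local Open Scope classical_set_scope.
Local Open Scope ring_scope.
Local Open Scope sesquilinear_scope.
Local Open Scope complex_scope.

(* [Normc.normc z : R] is the modulus as a real number; the generic [`|z|] would
   be an element of [R[i]]. *)
Definition l2norm (R : realType) (d : nat) (v : 'cV[R[i]]_d) : R :=
  Num.sqrt (\sum_(i < d) (Normc.normc (v i 0)) ^+ 2).

Definition opnorm (R : realType) (d : nat) (A : 'M[R[i]]_d) : R :=
  sup [set l2norm (A *m v) | v in [set v : 'cV[R[i]]_d | l2norm v <= 1]].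

(* The exponential series, summed entrywise: there is no topology instance
   for [R[i]], so real and imaginary parts are taken to the limit in [R]. *)
Definition mexp_partial (R : realType) (d : nat) (A : 'M[R[i]]_d) (N : nat) :
    'M[R[i]]_d :=
  \sum_(k < N) (k`!%:R : R[i])^-1 *: A ^+ k.

Definition mexp (R : realType) (d : nat) (A : 'M[R[i]]_d) : 'M[R[i]]_d :=
  \matrix_(i, j) (limn (fun N : nat => complex.Re (mexp_partial A N i j) : R)
               +i* limn (fun N : nat => complex.Im (mexp_partial A N i j) : R)).

Definition expi (R : realType) (d : nat) (H : 'M[R[i]]_d) : 'M[R[i]]_d :=
  mexp ('i *: H).

Definition su (R : realType) (d : nat) : set 'M[R[i]]_d :=
  [set H | H \is hermsymmx /\ \tr H = 0].

Definition SU (R : realType) (d : nat) : set 'M[R[i]]_d :=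
  [set U | U \is unitarymx /\ \det U = 1].

(* The physicists' bracket, for which [su] is closed. *)
Definition su_bracket (R : realType) (d : nat) (X Y : 'M[R[i]]_d) :
    'M[R[i]]_d :=
  'i *: (X *m Y - Y *m X).

(* Principal branch: the spectrum of the logarithm lies in ]-pi, pi]. *)
Definition is_principal_log (R : realType) (d : nat) (U H : 'M[R[i]]_d) : Prop :=
  [/\ H \is hermsymmx, expi H = U
    & forall t : R, eigenvalue H t%:C -> - pi < t <= pi].

Definition principal_log (R : realType) (d : nat) (U : 'M[R[i]]_d) :
    'M[R[i]]_d :=
  xget 0 [set H | is_principal_log U H].

Definition is_su_log (R : realType) (d : nat) (U H : 'M[R[i]]_d) : Prop :=
  [/\ su H, expi H = U, opnorm H <= 2 * pi
    & \tr (principal_log U) = 0 -> H = principal_log U].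

(* A fixed choice of logarithm; the default value [0] of [xget] is irrelevant
   because every [U] in [SU R d] has a logarithm in the sense of [is_su_log]. *)
Definition su_log (R : realType) (d : nat) (U : 'M[R[i]]_d) : 'M[R[i]]_d :=
  xget 0 [set H | is_su_log U H].

Definition rlincomb (R : realType) (d m : nat) (H : 'I_m -> 'M[R[i]]_d)
    (a : 'rV[R]_m) : 'M[R[i]]_d :=
  \sum_(j < m) (a 0 j)%:C *: H j.

Definition is_su_basis (R : realType) (d m : nat) (H : 'I_m -> 'M[R[i]]_d) :
    Prop :=
  [/\ forall j, su (H j),
      forall a : 'rV[R]_m, rlincomb H a = 0 -> a = 0
    & forall X, su X -> exists a : 'rV[R]_m, X = rlincomb H a].

Definition is_exp_basis (R : realType) (d m : nat) (G H : 'I_m -> 'M[R[i]]_d) :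
    Prop :=
  [/\ is_su_basis H,
      forall j, G j = expi (H j)
    & forall j, H j = su_log (G j)].

(* Negative powers use the adjoint generators. *)
Definition gpow (R : realType) (d : nat) (G : 'M[R[i]]_d) (c : int) :
    'M[R[i]]_d :=
  match c with
  | Posz k => G ^+ k
  | Negz k => (G ^t*) ^+ k.+1
  end.

Definition is_nearest_int (R : realType) (a : R) (c : int) : Prop :=
  forall k : int, `|a - c%:~R| <= `|a - k%:~R|.

(* A relation rather than a function of [U], since the nearest integer need not
   be unique: [V] is a possible output on input [U]. *)
Definition trotter_output (R : realType) (d m : nat)
    (G H : 'I_m -> 'M[R[i]]_d) (n : nat) (U V : 'M[R[i]]_d) : Prop :=
  exists (a : 'rV[R]_m) (c : 'I_m -> int),
    [/\ (n%:R^-1 : R)%:C *: su_log U = rlincomb H a,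
        forall j, is_nearest_int (a 0 j) (c j)
      & V = (\prod_(j < m) gpow (G j) (c j)) ^+ n].

(* [`|a|] on ['rV[R]_m] is the sup norm. *)
Definition basis_mu (R : realType) (d m : nat) (H : 'I_m -> 'M[R[i]]_d) : R :=
  inf [set opnorm (rlincomb H a) / `|a| | a in [set a : 'rV[R]_m | a != 0]].

Definition basis_hmax (R : realType) (d m : nat) (H : 'I_m -> 'M[R[i]]_d) : R :=
  \big[Num.max/0]_(j < m) opnorm (H j).

Definition basis_muN (R : realType) (d m : nat) (H : 'I_m -> 'M[R[i]]_d) : R :=
  basis_mu H / basis_hmax H.

(* The Baker-Campbell-Hausdorff estimate with constants [delta0] and [C],
   uniform in the dimension and in the number of factors. *)
Definition BCH_estimate (R : realType) (delta0 C : R) : Prop :=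
  forall (d r : nat) (X : 'I_r -> 'M[R[i]]_d) (delta : R),
    (2 <= d)%N ->
    (forall j, su (X j)) ->
    \sum_(j < r) opnorm (X j) <= delta -> delta <= delta0 ->
    opnorm (su_log (\prod_(j < r) expi (X j))
            - (\sum_(j < r) X j
               + 2^-1 *: \sum_(i < r) \sum_(j < r | (i < j)%N)
                           su_bracket (X i) (X j)))
      <= C * delta ^+ 3.

(* Main.v *)
(** Write [L = su_log U] and [L / n = \sum_j a_j H_j].  Since [|L| <= 2 pi], the
definition of [mu] gives [|a_j| <= 2 pi / (n mu)], and a nearest integer [c_j]
satisfies both [|c_j| <= 2 |a_j|] and [|c_j - a_j| <= 1/2].  Hence the steps
[X_j = c_j H_j] have total norm at most [delta = 4 pi M / (n mu_N)], where
[n delta^2] is of order [eps0 / K], and the BCH estimate puts the logarithm of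
[P = \prod_j expi X_j] within [(1 + C delta0) delta^2] of [\sum_j X_j], which is
itself within [M h_max / 2] of [L / n].  Because [expi] is 1-Lipschitz on
Hermitian matrices and [n]-th powers of unitaries are [n]-Lipschitz,
[|P^n - U|] is at most [n] times the sum of these two errors, each contributing
at most [eps0 / 2]. *)

Require Import Defs.
From mathcomp Require Import all_boot all_order all_algebra.
From mathcomp Require Import all_classical all_reals all_analysis.
From mathcomp Require Import complex ring lra.
Import Order.TTheory GRing.Theory Num.Theory.
Import numFieldNormedType.Exports.
Local Open Scope ring_scope.
Set Implicit Arguments.
Unset Strict Implicit.
Unset Printing Implicit Defensive.

(** * Euclidean norm of complex vectors and the operator norm *)

Section OperatorNorm.
Local Open Scope classical_set_scope.
Local Open Scope sesquilinear_scope.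
Local Open Scope complex_scope.
Context {R : realType}.
Implicit Types (z : R[i]).
Local Notation normc := Normc.normc.

Lemma normc_normr z : (normc z)%:C = `|z|.
Proof. by case: z. Qed.

Lemma normc_ge0 z : 0 <= normc z.
Proof. by case: z => a b; rewrite /= sqrtr_ge0. Qed.

Lemma l2norm_ge0 d (v : 'cV[R[i]]_d) : 0 <= l2norm v.
Proof. exact: sqrtr_ge0. Qed.

Lemma sqr_l2norm d (v : 'cV[R[i]]_d) :
  l2norm v ^+ 2 = \sum_(i < d) normc (v i 0) ^+ 2.
Proof. by rewrite sqr_sqrtr// sumr_ge0// => i _; rewrite sqr_ge0. Qed.

Lemma sqr_l2normC d (v : 'cV[R[i]]_d) :
  (l2norm v ^+ 2)%:C = (v ^t* *m v) 0 0.
Proof.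
rewrite sqr_l2norm rmorph_sum mxE; apply: eq_bigr => i _.
by rewrite rmorphXn /= normc_normr normCKC !mxE.
Qed.

Lemma l2normZ d z (v : 'cV[R[i]]_d) : l2norm (z *: v) = normc z * l2norm v.
Proof.
apply: (pexpIrn (n := 2)) => //; rewrite ?nnegrE ?mulr_ge0 ?l2norm_ge0 ?normc_ge0//.
rewrite exprMn !sqr_l2norm mulr_sumr; apply: eq_bigr => i _.
by rewrite mxE Normc.normcM exprMn.
Qed.

Lemma l2norm0 d : l2norm (0 : 'cV[R[i]]_d) = 0.
Proof. by rewrite -(scale0r 0) l2normZ Normc.normc0 mul0r. Qed.

Lemma l2normD d (u v : 'cV[R[i]]_d) : l2norm (u + v) <= l2norm u + l2norm v.
Proof.
(* The triangle inequality comes from the Hermitian form [dotmx], which acts on row vectors; hence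
   the transposes. *)
have l2normE (w : 'cV[R[i]]_d) : (l2norm w)%:C = sqrtC (dotmx w^T w^T).
  rewrite dotmxE; have := sqr_l2normC w.
  have -> : (w ^t* *m w) 0 0 = (w^T *m w^T ^t*) 0 0.
    by rewrite !mxE; apply: eq_bigr => i _; rewrite !mxE mulrC.
  by move=> <-; rewrite rmorphXn /= sqrCK// ler0c l2norm_ge0.
rewrite -lecR rmorphD /= !l2normE linearD.
by have [] := triangle_lerif (@dotmx R[i] d) u^T v^T.
Qed.

Lemma l2norm_sum d (I : finType) (P : pred I) (F : I -> 'cV[R[i]]_d) :
  l2norm (\sum_(i | P i) F i) <= \sum_(i | P i) l2norm (F i).
Proof.
elim/big_rec2: _ => [|i x y _ IH]; first by rewrite l2norm0.
by rewrite (le_trans (l2normD _ _))// lerD2l.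
Qed.

Lemma normc_le_l2norm d (v : 'cV[R[i]]_d) i : normc (v i 0) <= l2norm v.
Proof.
rewrite -(ler_pXn2r (n := 2))// ?nnegrE ?normc_ge0 ?l2norm_ge0//.
rewrite sqr_l2norm (bigD1 i)//= lerDl sumr_ge0// => j _.
by rewrite sqr_ge0.
Qed.

Lemma l2norm_delta d (i : 'I_d) : l2norm (delta_mx i 0 : 'cV[R[i]]_d) = 1.
Proof.
apply: (pexpIrn (n := 2)); rewrite ?nnegrE ?l2norm_ge0 ?ler01//.
rewrite sqr_l2norm (bigD1 i)//= big1 => [|j ji].
  by rewrite mxE !eqxx Normc.normc1 addr0.
by rewrite mxE (negPf ji) Normc.normc0 expr0n.
Qed.

Lemma l2norm_unitary d (U : 'M[R[i]]_d) v : U \is unitarymx ->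
  l2norm (U *m v) = l2norm v.
Proof.
move=> /unitarymxP/mulmx1C UU.
apply: (pexpIrn (n := 2)); rewrite ?nnegrE ?l2norm_ge0//.
apply: (@complexI R); rewrite !sqr_l2normC trmx_mul map_mxM mulmxA.
by rewrite -(mulmxA _ _ U) UU mulmx1.
Qed.

(** [A *m v] combines the columns of [A] with coefficients of modulus at most [l2norm v]. Some
    finite bound is needed before the [sup] in [opnorm] can be used as a supremum. *)
Lemma l2norm_mulmx_bounded d (A : 'M[R[i]]_d) : exists c : R,
  forall v, l2norm (A *m v) <= c * l2norm v.
Proof.
exists (\sum_j l2norm (col j A)) => v.
have -> : A *m v = \sum_j v j 0 *: col j A.
  apply/matrixP => i k; rewrite ord1 mxE summxE.
  by apply: eq_bigr => j _; rewrite !mxE mulrC.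
rewrite (le_trans (l2norm_sum _ _))// mulr_suml ler_sum// => j _.
by rewrite l2normZ mulrC ler_wpM2l ?l2norm_ge0// normc_le_l2norm.
Qed.

Lemma has_sup_opnorm d (A : 'M[R[i]]_d) :
  has_sup [set l2norm (A *m v) | v in [set v : 'cV[R[i]]_d | l2norm v <= 1]].
Proof.
split; first by exists (l2norm (A *m 0)), 0 => //=; rewrite l2norm0 ler01.
have [c Ac] := l2norm_mulmx_bounded A.
exists `|c| => _ [v /= v1 <-]; apply: (le_trans (Ac v)).
rewrite (le_trans (ler_wpM2r (l2norm_ge0 _) (ler_norm c)))//.
by rewrite -[leRHS]mulr1 ler_wpM2l.
Qed.

Lemma opnorm_ge0 d (A : 'M[R[i]]_d) : 0 <= opnorm A.
Proof.
apply: (le_trans (l2norm_ge0 (A *m 0))); apply: ub_le_sup.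
  by have [] := has_sup_opnorm A.
by exists 0 => //=; rewrite l2norm0 ler01.
Qed.

Lemma l2norm_mulmx d (A : 'M[R[i]]_d) v : l2norm (A *m v) <= opnorm A * l2norm v.
Proof.
(* A vector of norm zero cannot be normalised; any linear bound already forces its image to have
   norm zero. *)
have [v0|v0] := eqVneq (l2norm v) 0.
  have [c /(_ v)] := l2norm_mulmx_bounded A.
  by rewrite v0 !mulr0.
have vgt0 : 0 < l2norm v by rewrite lt_def v0 l2norm_ge0.
have nV : normc ((l2norm v)^-1)%:C = (l2norm v)^-1.
  by apply: (@complexI R); rewrite normc_normr ger0_norm// ler0c invr_ge0 l2norm_ge0.
rewrite -ler_pdivrMr// mulrC -nV -l2normZ scalemxAr.
apply: ub_le_sup; first by have [] := has_sup_opnorm A.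
by exists ((l2norm v)^-1%:C *: v) => //=; rewrite l2normZ nV mulVf.
Qed.

Lemma opnorm_le d (A : 'M[R[i]]_d) (c : R) : 0 <= c ->
  (forall v, l2norm (A *m v) <= c * l2norm v) -> opnorm A <= c.
Proof.
move=> c0 Ac; apply: ge_sup; first by have [] := has_sup_opnorm A.
by move=> _ [v /= v1 <-]; rewrite (le_trans (Ac v))// ler_piMr.
Qed.

Lemma opnormD d (A B : 'M[R[i]]_d) : opnorm (A + B) <= opnorm A + opnorm B.
Proof.
apply: opnorm_le => [|v]; first by rewrite addr_ge0 ?opnorm_ge0.
rewrite mulmxDl (le_trans (l2normD _ _))// mulrDl.
by rewrite lerD// l2norm_mulmx.
Qed.

Lemma opnorm0 d : opnorm (0 : 'M[R[i]]_d) = 0.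
Proof.
apply/le_anti/andP; split; last exact: opnorm_ge0.
by apply: opnorm_le => // v; rewrite mul0mx l2norm0 mul0r.
Qed.

Lemma opnorm_sum d (I : finType) (P : pred I) (F : I -> 'M[R[i]]_d) :
  opnorm (\sum_(i | P i) F i) <= \sum_(i | P i) opnorm (F i).
Proof.
elim/big_rec2: _ => [|i x y _ IH]; first by rewrite opnorm0.
by rewrite (le_trans (opnormD _ _))// lerD2l.
Qed.

Lemma opnormM d (A B : 'M[R[i]]_d) : opnorm (A *m B) <= opnorm A * opnorm B.
Proof.
apply: opnorm_le => [|v]; first by rewrite mulr_ge0 ?opnorm_ge0.
rewrite -mulmxA (le_trans (l2norm_mulmx _ _))// -mulrA.
by rewrite ler_wpM2l ?opnorm_ge0// l2norm_mulmx.
Qed.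

Lemma opnormZ_le d z (A : 'M[R[i]]_d) : opnorm (z *: A) <= normc z * opnorm A.
Proof.
apply: opnorm_le => [|v]; first by rewrite mulr_ge0 ?opnorm_ge0 ?normc_ge0.
by rewrite -scalemxAl l2normZ -mulrA ler_wpM2l ?normc_ge0// l2norm_mulmx.
Qed.

Lemma opnormZ d z (A : 'M[R[i]]_d) : opnorm (z *: A) = normc z * opnorm A.
Proof.
have [->|z0] := eqVneq z 0; first by rewrite scale0r Normc.normc0 mul0r opnorm0.
have nz0 : 0 < normc z.
  by rewrite lt_def normc_ge0 andbT; apply: contra z0 => /eqP/Normc.eq0_normc ->.
apply/le_anti/andP; split; first exact: opnormZ_le.
(* The reverse inequality is [opnormZ_le] for the scalar [z^-1] and the matrix [z *: A]. *)
rewrite -ler_pdivlMl// -Normc.normcV -{1}[A]scale1r -(mulVf z0) -scalerA.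
exact: opnormZ_le.
Qed.

Lemma opnormZr d (a : R) (A : 'M[R[i]]_d) : opnorm (a%:C *: A) = `|a| * opnorm A.
Proof. by rewrite opnormZ /= expr0n addr0 sqrtr_sqr. Qed.

Lemma opnormN d (A : 'M[R[i]]_d) : opnorm (- A) = opnorm A.
Proof. by rewrite -scaleN1r opnormZ normcN Normc.normc1 mul1r. Qed.

Lemma opnormB d (A B : 'M[R[i]]_d) : opnorm (A - B) <= opnorm A + opnorm B.
Proof. by rewrite -[opnorm B]opnormN; exact: opnormD. Qed.

Lemma opnorm_unitary_le1 d (U : 'M[R[i]]_d) : U \is unitarymx -> opnorm U <= 1.
Proof. by move=> uU; apply: opnorm_le => // v; rewrite l2norm_unitary// mul1r. Qed.

Lemma opnorm_diag_le d (s : 'rV[R[i]]_d) (c : R) : 0 <= c ->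
  (forall k, normc (s 0 k) <= c) -> opnorm (diag_mx s) <= c.
Proof.
move=> c0 sc; apply: opnorm_le => // v.
rewrite -(ler_pXn2r (n := 2))// ?nnegrE ?mulr_ge0 ?l2norm_ge0//.
rewrite exprMn !sqr_l2norm mulr_sumr ler_sum// => k _.
rewrite mul_diag_mx mxE Normc.normcM exprMn ler_wpM2r ?sqr_ge0//.
by rewrite ler_pXn2r// nnegrE ?normc_ge0.
Qed.

Lemma opnorm_conj_unitary_le d (V A : 'M[R[i]]_d) : V \is unitarymx ->
  opnorm (V ^t* *m A *m V) <= opnorm A.
Proof.
move=> uV; rewrite -[leRHS]mul1r -[leRHS]mulr1.
rewrite (le_trans (opnormM _ _))// ler_pM ?opnorm_ge0 ?opnorm_unitary_le1//.
rewrite (le_trans (opnormM _ _))// ler_wpM2r ?opnorm_ge0//.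
by apply: opnorm_unitary_le1; rewrite trmxC_unitary.
Qed.

Lemma normc_le_opnorm d (A : 'M[R[i]]_d) i j : normc (A i j) <= opnorm A.
Proof.
have -> : A i j = (A *m delta_mx j 0 : 'cV_d) i 0 by rewrite -colE mxE.
rewrite (le_trans (normc_le_l2norm _ _))//.
by rewrite (le_trans (l2norm_mulmx _ _))// l2norm_delta mulr1.
Qed.

Lemma opnorm_bracket d (X Y : 'M[R[i]]_d) :
  opnorm (su_bracket X Y) <= 2 * (opnorm X * opnorm Y).
Proof.
have n1 : normc (R := R) 'i = 1 by rewrite /= expr0n expr1n add0r sqrtr1.
rewrite /su_bracket opnormZ n1 mul1r (le_trans (opnormB _ _))//.
rewrite mulr2n mulrDl mul1r; apply: lerD; first exact: opnormM.
by rewrite mulrC; exact: opnormM.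
Qed.

End OperatorNorm.

(** * Functional calculus in a unitary eigenbasis and the matrix exponential *)

Section UnitaryExponential.
Local Open Scope classical_set_scope.
Local Open Scope sesquilinear_scope.
Local Open Scope complex_scope.
Context {R : realType}.
Local Notation normc := Normc.normc.

(** The number $e^{it}$, given by its real and imaginary parts because [mexp] takes these two limits
    separately. *)
Definition cis (t : R) : R[i] := cos t +i* sin t.

Lemma cis0 : cis 0 = 1.
Proof. by rewrite /cis cos0 sin0. Qed.

Lemma cisD (x y : R) : cis (x + y) = cis x * cis y.
Proof. by rewrite /cis cosD sinD; simpc; rewrite [sin x * _ + _]addrC. Qed.

Lemma cis_conj (x : R) : (cis x)^* = cis (- x).
Proof. by rewrite /cis cosN sinN. Qed.

Lemma cisX (x : R) n : cis x ^+ n = cis (n%:R * x).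
Proof.
elim: n => [|n IH]; first by rewrite mul0r cis0.
by rewrite exprS IH -cisD -natr1 mulrDl mul1r addrC.
Qed.

Lemma cis_sum (I : finType) (F : I -> R) : cis (\sum_i F i) = \prod_i cis (F i).
Proof. exact: (big_morph cis cisD cis0). Qed.

Lemma cis_periodicB (x : R) : cis (x - 2 * pi) = cis x.
Proof.
by rewrite /cis mulr_natl -[x in RHS](subrK (pi *+ 2)) cosD2pi sinD2pi.
Qed.

Definition expi_partial (t : R) (N : nat) : R[i] :=
  \sum_(k < N) (k`!%:R)^-1 * ('i * t%:C) ^+ k.

Lemma expi_partialE (t : R) N :
  expi_partial t N = series (cos_coeff t) N +i* series (sin_coeff t) N.
Proof.
rewrite /expi_partial /series /= !big_mkord; elim: N => [|N IH].
  by rewrite !big_ord0.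
have iX m : ('i : R[i]) ^+ m.*2 = ((-1) ^+ m)%:C.
  by rewrite -mul2n exprM sqr_i rmorphXn /= rmorphN1.
have nV : ((N`!%:R)^-1 : R[i]) = (N`!%:R^-1)%:C by rewrite fmorphV /= rmorph_nat.
rewrite !big_ord_recr /= IH exprMn -rmorphXn nV /cos_coeff /sin_coeff /=.
(* The power of ['i] is real for even [N] and imaginary for odd [N], so each new term enters exactly
   one of the two real series. *)
rewrite -[N in 'i ^+ N]odd_double_half exprD iX.
case oN: (odd N) => /=.
  have -> : N.-1./2 = N./2 by rewrite -[N in LHS]odd_double_half oN /= doubleK.
  rewrite expr1; simpc; congr (_ +i* _); rewrite ?mul0r ?addr0//.
  by congr (_ + _); rewrite mulrC.
rewrite expr0 -exprnP; simpc; congr (_ +i* _); rewrite ?mul0r ?addr0//.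
by congr (_ + _); rewrite mulrC.
Qed.

Lemma cvg_series_cos_coeff (t : R) :
  series (cos_coeff t) @ \oo --> cos t.
Proof. by rewrite unlock; exact: is_cvg_series_cos_coeff. Qed.

Lemma cvg_series_sin_coeff (t : R) :
  series (sin_coeff t) @ \oo --> sin t.
Proof. by rewrite unlock; exact: is_cvg_series_sin_coeff. Qed.

(** Functional calculus for a fixed eigenbasis, the rows of [V]: for unitary [V], products, powers
    and adjoints act on the eigenvalues [s] pointwise. *)
Definition udiag d (V : 'M[R[i]]_d) (s : 'I_d -> R[i]) : 'M[R[i]]_d :=
  V ^t* *m diag_mx (\row_k s k) *m V.

Lemma udiagE d (V : 'M[R[i]]_d) s i j :
  udiag V s i j = \sum_k (V k i)^* * V k j * s k.
Proof.
rewrite !mxE; apply: eq_bigr => k _.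
by rewrite mul_mx_diag !mxE mulrAC.
Qed.

Lemma eq_udiag d (V : 'M[R[i]]_d) s t : s =1 t -> udiag V s = udiag V t.
Proof.
move=> st; apply/matrixP => i j; rewrite !udiagE.
by apply: eq_bigr => k _; rewrite st.
Qed.

Lemma udiagM d (V : 'M[R[i]]_d) s t : V \is unitarymx ->
  udiag V s *m udiag V t = udiag V (fun k => s k * t k).
Proof.
move=> /unitarymxP VV; rewrite /udiag !mulmxA -(mulmxA _ V) VV mulmx1.
rewrite -(mulmxA _ (diag_mx _) (diag_mx _)) mulmx_diag.
rewrite (_ : \row_j _ = \row_k (s k * t k)) //.
by apply/rowP => k; rewrite !mxE.
Qed.

Lemma udiag1 d (V : 'M[R[i]]_d) : V \is unitarymx -> udiag V (fun=> 1) = 1%:M.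
Proof.
move=> /unitarymxP/mulmx1C VV; rewrite /udiag.
rewrite (_ : \row__ 1 = const_mx 1) ?diag_const_mx ?mulmx1//.
by apply/rowP => k; rewrite !mxE.
Qed.

Lemma udiagX d (V : 'M[R[i]]_d) s n : V \is unitarymx ->
  udiag V s ^+ n = udiag V (fun k => s k ^+ n).
Proof.
move=> uV; elim: n => [|n IH]; first exact/esym/udiag1.
by rewrite exprS IH [LHS](udiagM _ _ uV); apply: eq_udiag => k; rewrite exprS.
Qed.

Lemma udiagZ d (V : 'M[R[i]]_d) z s :
  z *: udiag V s = udiag V (fun k => z * s k).
Proof.
apply/matrixP => i j; rewrite mxE !udiagE mulr_sumr.
by apply: eq_bigr => k _; rewrite mulrCA.
Qed.

Lemma udiagD d (V : 'M[R[i]]_d) s t :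
  udiag V s + udiag V t = udiag V (fun k => s k + t k).
Proof.
apply/matrixP => i j; rewrite mxE !udiagE -big_split.
by apply: eq_bigr => k _; rewrite mulrDr.
Qed.

Lemma udiag_adj d (V : 'M[R[i]]_d) s :
  (udiag V s) ^t* = udiag V (fun k => (s k)^*).
Proof.
apply/matrixP => i j; rewrite mxE mxE !udiagE rmorph_sum; apply: eq_bigr => k _.
by rewrite !rmorphM /= conjCK; congr (_ * _); rewrite mulrC.
Qed.

Lemma udiag_det d (V : 'M[R[i]]_d) s : V \is unitarymx ->
  \det (udiag V s) = \prod_k s k.
Proof.
move=> /unitarymxP VV; rewrite !det_mulmx mulrAC -det_mulmx.
rewrite (mulmx1C VV) det1 mul1r det_diag.
by apply: eq_bigr => k _; rewrite mxE.
Qed.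

Lemma udiag_tr d (V : 'M[R[i]]_d) s : V \is unitarymx ->
  \tr (udiag V s) = \sum_k s k.
Proof.
move=> /unitarymxP VV; rewrite mxtrace_mulC mulmxA VV mul1mx mxtrace_diag.
by apply: eq_bigr => k _; rewrite mxE.
Qed.

Lemma udiag_opnorm_le d (V : 'M[R[i]]_d) s c : V \is unitarymx -> 0 <= c ->
  (forall k, normc (s k) <= c) -> opnorm (udiag V s) <= c.
Proof.
move=> uV c0 sc; apply: (le_trans (opnorm_conj_unitary_le _ uV)).
by apply: opnorm_diag_le => // k; rewrite mxE.
Qed.

(** A real spectrum: for unitary [V] these are exactly the Hermitian matrices diagonalised by
    [V]. *)
Definition hdiag d (V : 'M[R[i]]_d) (t : 'I_d -> R) : 'M[R[i]]_d :=
  udiag V (fun k => (t k)%:C).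

Lemma real_complexM (a b : R) : (a * b)%:C = a%:C * b%:C.
Proof. by simpc. Qed.

Lemma hdiagZ d (V : 'M[R[i]]_d) a t :
  a%:C *: hdiag V t = hdiag V (fun k => a * t k).
Proof. by rewrite /hdiag udiagZ; apply: eq_udiag => k; rewrite real_complexM. Qed.

(** Each entry of a partial sum is a fixed finite combination of the scalar partial sums of
    $e^{it_k}$, so the entrywise limits reduce to the cosine and sine series. Later facts on [expi]
    are read off from the eigenvalues through this formula. *)
Lemma expi_hdiag d (V : 'M[R[i]]_d) (t : 'I_d -> R) : V \is unitarymx ->
  expi (hdiag V t) = udiag V (fun k => cis (t k)).
Proof.
move=> uV; rewrite /expi.
have pE N : mexp_partial ('i *: hdiag V t) N =
    udiag V (fun k => expi_partial (t k) N).
  rewrite /mexp_partial /hdiag udiagZ /expi_partial; apply/matrixP => i j.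
  rewrite summxE udiagE; under [RHS]eq_bigr do rewrite mulr_sumr.
  rewrite exchange_big; apply: eq_bigr => k _.
  by rewrite udiagX// udiagZ udiagE.
apply/matrixP => i j; rewrite mxE udiagE.
set w := fun k => (V k i)^* * V k j.
have ReS (F : 'I_d -> R[i]) : complex.Re (\sum_k F k) = \sum_k complex.Re (F k).
  by apply: (big_morph (@complex.Re R) (id1 := 0) (op1 := +%R)) => // [[a b] [e f]].
have ImS (F : 'I_d -> R[i]) : complex.Im (\sum_k F k) = \sum_k complex.Im (F k).
  by apply: (big_morph (@complex.Im R) (id1 := 0) (op1 := +%R)) => // [[a b] [e f]].
have ReM (a b : R[i]) : complex.Re (a * b) =
   complex.Re a * complex.Re b - complex.Im a * complex.Im b.
  by case: a b => [? ?] [? ?].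
have ImM (a b : R[i]) : complex.Im (a * b) =
   complex.Re a * complex.Im b + complex.Im a * complex.Re b.
  by case: a b => [? ?] [? ?].
have cR : (fun N => complex.Re (mexp_partial ('i *: hdiag V t) N i j))
    @ \oo --> complex.Re (\sum_k w k * cis (t k)).
  under eq_cvg do rewrite pE udiagE ReS.
  rewrite ReS; apply: cvg_big => [|k _]; first exact: add_continuous.
  under eq_cvg do rewrite expi_partialE ReM /=.
  rewrite ReM /=; apply: cvgB; apply: cvgMl_tmp.
    exact: cvg_series_cos_coeff.
  exact: cvg_series_sin_coeff.
have cI : (fun N => complex.Im (mexp_partial ('i *: hdiag V t) N i j))
    @ \oo --> complex.Im (\sum_k w k * cis (t k)).
  under eq_cvg do rewrite pE udiagE ImS.
  rewrite ImS; apply: cvg_big => [|k _]; first exact: add_continuous.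
  under eq_cvg do rewrite expi_partialE ImM /=.
  rewrite ImM /=; apply: cvgD; apply: cvgMl_tmp.
    exact: cvg_series_sin_coeff.
  exact: cvg_series_cos_coeff.
by rewrite (cvg_lim _ cR)// (cvg_lim _ cI)//; case: (\sum_k _).
Qed.

Lemma hermsymmxE d (A : 'M[R[i]]_d) : (A \is hermsymmx) = (A == A ^t*).
Proof. by rewrite is_hermitianmxE expr0 scale1r. Qed.

Lemma hermsymmx_hdiag d (V : 'M[R[i]]_d) (t : 'I_d -> R) :
  hdiag V t \is hermsymmx.
Proof.
rewrite hermsymmxE /hdiag udiag_adj; apply/eqP/eq_udiag => k.
by rewrite conjc_real.
Qed.

Lemma hdiag_tr d (V : 'M[R[i]]_d) t : V \is unitarymx ->
  \tr (hdiag V t) = (\sum_k t k)%:C.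
Proof. by move=> uV; rewrite /hdiag (udiag_tr _ uV) rmorph_sum. Qed.

Lemma hermsymmx_spectral d (A : 'M[R[i]]_d) : A \is hermsymmx ->
  exists (V : 'M[R[i]]_d) (t : 'I_d -> R), V \is unitarymx /\ A = hdiag V t.
Proof.
move=> hA; have /hermitian_normalmx/orthomx_spectralP AE := hA.
have /mxOverP sR := hermitian_spectral_diag_real hA.
exists (spectralmx A), (fun k => complex.Re (spectral_diag A 0 k)).
have uV := spectral_unitarymx A; split=> //.
rewrite [LHS]AE (invmx_unitary uV) /hdiag /udiag.
rewrite (_ : \row_k _ = spectral_diag A) //.
by apply/rowP => k; rewrite mxE RRe_real.
Qed.

End UnitaryExponential.

(** * Exponentials of Hermitian matrices: unitarity and Lipschitz estimates *)

Section HermitianExponential.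
Local Open Scope classical_set_scope.
Local Open Scope sesquilinear_scope.
Local Open Scope complex_scope.
Context {R : realType}.
Local Notation normc := Normc.normc.

Lemma hermsymmxZ d (a : R) (A : 'M[R[i]]_d) :
  A \is hermsymmx -> a%:C *: A \is hermsymmx.
Proof.
move=> /hermsymmx_spectral[V [t [_ ->]]].
by rewrite hdiagZ; exact: hermsymmx_hdiag.
Qed.

Lemma suZ d (a : R) (A : 'M[R[i]]_d) : su A -> su (a%:C *: A).
Proof. by case=> hA tA; split; [exact: hermsymmxZ|rewrite mxtraceZ tA mulr0]. Qed.

Lemma expi_natmul d (A : 'M[R[i]]_d) n : A \is hermsymmx ->
  expi (n%:R%:C *: A) = expi A ^+ n.
Proof.
move=> /hermsymmx_spectral[V [t [uV ->]]].
rewrite hdiagZ [LHS](expi_hdiag _ uV) (expi_hdiag _ uV) (udiagX _ _ uV).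
by apply: eq_udiag => k; rewrite cisX.
Qed.

Lemma expi_adj d (A : 'M[R[i]]_d) : A \is hermsymmx ->
  (expi A) ^t* = expi ((-1)%:C *: A).
Proof.
move=> /hermsymmx_spectral[V [t [uV ->]]].
rewrite hdiagZ [RHS](expi_hdiag _ uV) (expi_hdiag _ uV) udiag_adj.
by apply: eq_udiag => k; rewrite mulN1r -cis_conj.
Qed.

(** Turns each factor of the algorithm, inverse powers included, into a single exponential, the form
    that the BCH estimate accepts. [Negz n] stands for $-(n+1)$. *)
Lemma gpow_expi d (A : 'M[R[i]]_d) (c : int) : A \is hermsymmx ->
  gpow (expi A) c = expi ((c%:~R)%:C *: A).
Proof.
move=> hA; case: c => n; first by rewrite /= -expi_natmul.
rewrite [LHS]/gpow (expi_adj hA) -(expi_natmul n.+1 (hermsymmxZ _ hA)).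
have -> : (Negz n)%:~R = n.+1%:R * -1 :> R by rewrite mulrN1 NegzE mulrNz.
by rewrite scalerA real_complexM.
Qed.

Lemma expi_unitary d (A : 'M[R[i]]_d) : A \is hermsymmx -> expi A \is unitarymx.
Proof.
move=> /hermsymmx_spectral[V [t [uV ->]]].
rewrite (expi_hdiag _ uV); apply/unitarymxP.
rewrite udiag_adj (udiagM _ _ uV) -(udiag1 uV); apply: eq_udiag => k.
by rewrite cis_conj -cisD subrr cis0.
Qed.

(** The determinant is the product of the $e^{it_k}$, that is, $e^{i\sum_k t_k}$, and the trace is
    $\sum_k t_k$. *)
Lemma expi_su d (A : 'M[R[i]]_d) : su A -> SU (expi A).
Proof.
move=> [hA]; split; first exact: expi_unitary.
move: hA b => /hermsymmx_spectral[V [t [uV ->]]].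
rewrite (expi_hdiag _ uV) (udiag_det _ uV) (hdiag_tr _ uV) -cis_sum => /complexI ->.
exact: cis0.
Qed.

Lemma SU_prod d (I : finType) (F : I -> 'M[R[i]]_d) :
  (forall j, SU (F j)) -> SU (\prod_j F j).
Proof.
move=> SF; apply: big_ind => //.
  by split; [apply/unitarymxP; rewrite trmx1 map_mx1 mulmx1|exact: det1].
move=> A B [uA dA] [uB dB]; split; first exact: mul_unitarymx.
by rewrite det_mulmx dA dB mulr1.
Qed.

Lemma unitarymxX d (U : 'M[R[i]]_d) n : U \is unitarymx -> U ^+ n \is unitarymx.
Proof.
move=> uU; elim: n => [|n IH]; last by rewrite exprS; exact: (mul_unitarymx uU IH).
by rewrite expr0; apply/unitarymxP; rewrite trmx1 map_mx1 mulmx1.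
Qed.

(** Telescoping: each exchange of one factor [P] for [Q] costs at most [opnorm (P - Q)], since
    unitary factors do not increase the norm. *)
Lemma opnorm_subrX_unitary d (P Q : 'M[R[i]]_d) n :
  P \is unitarymx -> Q \is unitarymx ->
  opnorm (P ^+ n - Q ^+ n) <= n%:R * opnorm (P - Q).
Proof.
move=> uP uQ; elim: n => [|n IH]; first by rewrite !expr0 subrr opnorm0 mul0r.
have -> : P ^+ n.+1 - Q ^+ n.+1 = P *m (P ^+ n - Q ^+ n) + (P - Q) *m Q ^+ n.
  by rewrite !exprS mulmxBr mulmxBl addrA subrK.
apply: (le_trans (opnormD _ _)); rewrite -natr1 mulrDl mul1r; apply: lerD.
  apply: (le_trans (opnormM _ _)); apply: le_trans IH.
  by apply: ler_piMl; [exact: opnorm_ge0|exact: opnorm_unitary_le1].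
apply: (le_trans (opnormM _ _)); apply: ler_piMr; first exact: opnorm_ge0.
exact/opnorm_unitary_le1/unitarymxX.
Qed.

(** Mean value theorem on either side of [0]. The derivative is bounded only where [|x| <= |t|], so
    that the bounds for sine, cosine and sine again can be chained below. *)
Lemma dist_le_mul_bound (f df : R -> R) (t c : R) :
  (forall x : R, is_derive x 1 f (df x)) ->
  (forall x, `|x| <= `|t| -> `|df x| <= c) -> `|f t - f 0| <= c * `|t|.
Proof.
move=> fdf dfc.
have cf a b : {within `[a, b], continuous f}.
  apply: continuous_subspaceT => x; apply: differentiable_continuous.
  by apply/derivable1_diffP/ex_derive.
have [t0|t0] := leP 0 t.
  have [x /[!in_itv]/= /andP[x0 xt] ->] :=
    MVT_segment t0 (fun x _ => fdf x) (cf _ _).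
  by rewrite subr0 normrM ler_wpM2r// dfc// !ger0_norm.
have [x /[!in_itv]/= /andP[x0 xt] E] :=
  MVT_segment (ltW t0) (fun x _ => fdf x) (cf _ _).
rewrite distrC E sub0r normrM normrN ler_wpM2r// dfc//.
by rewrite !ler0_norm// ?(ltW t0)// lerN2.
Qed.

Lemma sin_le_norm (t : R) : `|sin t| <= `|t|.
Proof.
have := @dist_le_mul_bound sin cos t 1; rewrite sin0 subr0 mul1r; apply.
by move=> x _; exact: cos_max.
Qed.

Lemma cos_sub1_le (t : R) : `|cos t - 1| <= t ^+ 2.
Proof.
have := @dist_le_mul_bound cos (fun x => - sin x) t `|t|.
rewrite cos0 -expr2 real_normK ?num_real//; apply=> x xt.
by rewrite normrN (le_trans (sin_le_norm x)).
Qed.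

Lemma sin_sub_le (t : R) : `|sin t - t| <= `|t| ^+ 3.
Proof.
have := @dist_le_mul_bound (fun x => sin x - x) (fun x => cos x - 1) t (`|t| ^+ 2).
rewrite sin0 !subr0 -exprSr; apply=> x xt.
by rewrite (le_trans (cos_sub1_le x))// -real_normK ?num_real// ler_pXn2r ?nnegrE.
Qed.

Lemma normc_le_sum (a b : R) : normc (a +i* b) <= `|a| + `|b|.
Proof.
have -> : a +i* b = a%:C + 'i * b%:C by simpc.
rewrite (le_trans (le_normcD _ _))// Normc.normcM /= !expr0n /= addr0 add0r.
by rewrite expr1n sqrtr1 mul1r addr0 !sqrtr_sqr.
Qed.

Lemma normc_cis_taylor1 (t : R) :
  normc (cis t - (1 + 'i * t%:C)) <= t ^+ 2 + `|t| ^+ 3.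
Proof.
have -> : cis t - (1 + 'i * t%:C) = (cos t - 1) +i* (sin t - t).
  by apply/eqP; rewrite eq_complex /=; apply/andP; split; apply/eqP; ring.
by rewrite (le_trans (normc_le_sum _ _))// lerD ?cos_sub1_le ?sin_sub_le.
Qed.

(** The scalar Taylor estimate is applied to every eigenvalue; [c] may depend on [A] because only
    the decay in [m] is used. *)
Lemma opnorm_expi_taylor1 d (A : 'M[R[i]]_d) : A \is hermsymmx ->
  exists2 c : R, 0 <= c & forall m, (0 < m)%N ->
   opnorm (expi (m%:R^-1%:C *: A) - (1%:M + 'i *: (m%:R^-1%:C *: A)))
     <= c / m%:R ^+ 2.
Proof.
move=> /hermsymmx_spectral[V [t [uV ->]]].
pose c := \sum_k ((t k) ^+ 2 + `|t k| ^+ 3).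
have c0 : 0 <= c by rewrite sumr_ge0// => k _; rewrite addr_ge0 ?sqr_ge0 ?exprn_ge0.
exists c; [by []|move=> m m0].
rewrite hdiagZ (expi_hdiag _ uV) /hdiag udiagZ -(udiag1 uV) [X in _ - X]udiagD.
rewrite -scaleN1r udiagZ udiagD.
have mgt0 : 0 < m%:R :> R by rewrite ltr0n.
apply: udiag_opnorm_le => // [|k]; first by rewrite divr_ge0// sqr_ge0.
rewrite mulN1r (le_trans (normc_cis_taylor1 _))//.
have tkc : t k ^+ 2 + `|t k| ^+ 3 <= c.
  rewrite /c (bigD1 k)//= lerDl sumr_ge0// => j _.
  by rewrite addr_ge0 ?sqr_ge0 ?exprn_ge0.
rewrite (le_trans _ (ler_wpM2r _ tkc)) ?invr_ge0 ?sqr_ge0// mulrDl.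
rewrite exprMn exprVn mulrC lerD2l normrM exprMn [leLHS]mulrC.
rewrite ler_wpM2l ?exprn_ge0// ger0_norm ?invr_ge0 ?(ltW mgt0)//.
(* The cubic term carries $m^{-3}$, which is at most $m^{-2}$ as $m\ge1$. *)
by rewrite -exprVn ler_wiXn2l ?invr_ge0 ?(ltW mgt0)// invf_le1// ler1n.
Qed.

(* Both exponentials are m-th powers of unitaries that differ by
   [(A - B) / m + O(m^-2)]; let m go to infinity. *)
Lemma opnorm_expiB d (A B : 'M[R[i]]_d) : A \is hermsymmx -> B \is hermsymmx ->
  opnorm (expi A - expi B) <= opnorm (A - B).
Proof.
move=> hA hB.
have [a a0 Aa] := opnorm_expi_taylor1 hA.
have [b b0 Bb] := opnorm_expi_taylor1 hB.
have root (C : 'M[R[i]]_d) m : (0 < m)%N -> C \is hermsymmx ->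
    expi C = expi (m%:R^-1%:C *: C) ^+ m.
  move=> m0 hC; rewrite -(expi_natmul _ (hermsymmxZ _ hC)) scalerA -real_complexM.
  have -> : m%:R / m%:R = 1 :> R by rewrite divff// pnatr_eq0 -lt0n.
  by rewrite scale1r.
have key m : (0 < m)%N ->
    opnorm (expi A - expi B) <= opnorm (A - B) + (a + b) / m%:R.
  move=> m0; have mgt0 : 0 < m%:R :> R by rewrite ltr0n.
  rewrite (root A m m0 hA) (root B m m0 hB).
  have uA := expi_unitary (hermsymmxZ (m%:R^-1) hA).
  have uB := expi_unitary (hermsymmxZ (m%:R^-1) hB).
  apply: (le_trans (opnorm_subrX_unitary _ uA uB)).
  set X := expi _; set Y := expi _.
  set A' := _^-1%:C *: A in X *; set B' := _^-1%:C *: B in Y *.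
  have -> : X - Y =
      (X - (1%:M + 'i *: A')) - (Y - (1%:M + 'i *: B')) + 'i *: (A' - B').
    rewrite scalerBr; move: X Y ('i *: A') ('i *: B') => x y u v.
    by apply/matrixP => i j; rewrite !mxE; ring.
  rewrite -(ler_pdivlMl _ _ mgt0) mulrDr; apply: (le_trans (opnormD _ _)).
  rewrite addrC; apply: lerD.
    rewrite opnormZ /A' /B' -scalerBr opnormZr /= expr0n expr1n add0r sqrtr1 mul1r.
    by rewrite ger0_norm ?invr_ge0 ?(ltW mgt0).
  apply: (le_trans (opnormB _ _)); rewrite mulrCA -invfM -expr2 mulrDl.
  by apply: lerD; [exact: Aa|exact: Bb].
rewrite leNgt; apply/negP => lt.
set e := opnorm (expi A - expi B) - opnorm (A - B).
have e0 : 0 < e by rewrite subr_gt0.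
(* By this choice [(a + b) / m < e], which contradicts [key m]. *)
pose m := (Num.truncn ((a + b) / e)).+1.
have := key m isT; rewrite -lerBlDl -/e leNgt => /negP; apply.
rewrite ltr_pdivrMr ?ltr0n// mulrC -ltr_pdivrMr//.
by rewrite truncnS_gt.
Qed.

End HermitianExponential.

(** * Existence of principal and traceless logarithms *)

Section SuLogarithm.
Local Open Scope classical_set_scope.
Local Open Scope sesquilinear_scope.
Local Open Scope complex_scope.
Context {R : realType}.
Local Notation normc := Normc.normc.

(** Cosine is injective on $[0,\pi]$; for larger [y] the reflection $2\pi-y$ falls in that interval
    and would have to be zero. *)
Lemma cos_eq1_lt2pi (y : R) : 0 <= y < 2 * pi -> cos y = 1 -> y = 0.
Proof.
move=> /andP[y0 y2pi] cy.
have [ypi|ypi] := leP y pi.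
  by rewrite -(cosK (x := y)) ?in_itv/= ?y0// cy acos1.
have c2 : cos (2 * pi - y) = 1.
  by rewrite -cosN opprB mulr_natl -[in RHS]cy -[in RHS](subrK (pi *+ 2) y) cosD2pi.
have : 2 * pi - y = 0.
  by rewrite -(cosK (x := 2 * pi - y)) ?in_itv/= ?c2 ?acos1//; lra.
by lra.
Qed.

Lemma cis_eq1 (x : R) : cis x = 1 -> exists k : int, x = 2 * pi * k%:~R.
Proof.
move=> [cx _]; have pi0 : 0 < 2 * pi :> R by rewrite mulr_gt0 ?pi_gt0.
(* The remainder $x-2\pi k$ lies in $[0,2\pi)$ and has the same cosine as [x]. *)
pose k := Num.floor (x / (2 * pi)); exists k.
have /andP[k1 k2] := floor_itv (x / (2 * pi)).
apply/eqP; rewrite -subr_eq0; apply/eqP/cos_eq1_lt2pi.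
  rewrite subr_ge0 mulrC -ler_pdivlMr// k1 /=.
  by move: k2; rewrite intrD ltr_pdivrMr// mulrDl mul1r ltrBlDl.
have cosZ (n : nat) y : cos (y + 2 * pi * n%:R) = cos y :> R.
  rewrite [2 * pi]mulr_natl mulr_natr; exact: (periodicn (@cosD2pi R)).
rewrite -[RHS]cx; case: k k1 k2 => n _ _.
  by rewrite -[in RHS](subrK (2 * pi * n%:R) x) cosZ.
by rewrite NegzE mulrNz mulrN opprK cosZ.
Qed.

Lemma cis_surj (z : R[i]) : normc z = 1 -> exists2 t : R, - pi < t <= pi & cis t = z.
Proof.
case: z => a b /= /(congr1 (fun x => x ^+ 2)); rewrite expr1n.
rewrite sqr_sqrtr ?addr_ge0 ?sqr_ge0// => ab.
have b2 : b ^+ 2 = 1 - a ^+ 2 by rewrite -ab addrC addKr.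
have a1 : -1 <= a <= 1 by have := sqr_ge0 b; rewrite b2 => ?; apply/andP; nra.
have pi0 := pi_gt0 R.
have [b0|b0] := leP 0 b.
  exists (acos a).
    by rewrite (lt_le_trans _ (acos_ge0 a1)) ?oppr_lt0//= acos_lepi.
  by rewrite /cis acosK ?in_itv// sin_acos// -b2 sqrtr_sqr ger0_norm.
(* Strictness keeps [acos a] below $\pi$, so that [- acos a] stays off the excluded endpoint
   $-\pi$. *)
have aN1 : -1 < a by move: a1 => /andP[]; nra.
exists (- acos a).
  rewrite ltrN2 acos_ltpi; last by rewrite aN1; case/andP: a1.
  by rewrite (le_trans _ (ltW pi0))// oppr_le0 acos_ge0.
by rewrite /cis cosN sinN acosK ?in_itv// sin_acos// -b2 sqrtr_sqr ltr0_norm// opprK.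
Qed.

(* A positive sum contains a positive angle, and subtracting [2 pi] from it keeps
   it in [[-2 pi, 2 pi]]. *)
Lemma shift_angles_nat d (t : 'I_d -> R) (m : nat) :
  (forall k, `|t k| <= 2 * pi) -> \sum_k t k = 2 * pi * m%:R ->
  exists u : 'I_d -> R, [/\ forall k, `|u k| <= 2 * pi, \sum_k u k = 0
    & forall k, cis (u k) = cis (t k)].
Proof.
have pi0 := pi_gt0 R.
elim: m t => [|m IH] t tb ts; first by exists t; rewrite ts mulr0.
have [k0 tk0] : exists k, 0 < t k.
  apply: contrapT => /forallNP tN.
  have : \sum_k t k <= 0.
    by rewrite sumr_le0// => k _; rewrite leNgt; apply/negP/tN.
  by rewrite ts leNgt !mulr_gt0.
pose u k := t k - (if k == k0 then 2 * pi else 0).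
have [|| v [vb vs vt]] := IH u.
- move=> k; rewrite /u; case: eqP => [->|_]; last by rewrite subr0.
  by have := tb k0; rewrite !ler_norml; lra.
- rewrite sumrB ts -big_mkcond big_pred1_eq -natr1; lra.
exists v; split=> // k; rewrite vt /u; case: eqP => [->|_]; last by rewrite subr0.
exact: cis_periodicB.
Qed.

(** The sum is an integer multiple of $2\pi$; a negative multiple becomes a positive one when all
    angles are negated. This removes the trace of a logarithm while keeping its exponential and the
    bound $2\pi$. *)
Lemma shift_angles d (t : 'I_d -> R) :
  (forall k, `|t k| <= 2 * pi) -> cis (\sum_k t k) = 1 ->
  exists u : 'I_d -> R, [/\ forall k, `|u k| <= 2 * pi, \sum_k u k = 0
    & forall k, cis (u k) = cis (t k)].
Proof.
move=> tb /cis_eq1[[m|m] ts]; first exact: shift_angles_nat tb ts.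
have [||u [ub us ut]] := @shift_angles_nat d (fun k => - t k) m.+1.
- by move=> k; rewrite normrN.
- by rewrite sumrN ts NegzE mulrNz mulrN opprK.
exists (fun k => - u k); split=> [k||k]; first by rewrite normrN.
  by rewrite sumrN us oppr0.
by rewrite -cis_conj ut cis_conj opprK.
Qed.

Lemma udiag_inj d (V : 'M[R[i]]_d) s t : V \is unitarymx ->
  udiag V s = udiag V t -> s =1 t.
Proof.
move=> /unitarymxP VV; pose f (A : 'M[R[i]]_d) := V *m A *m V ^t*.
have fE r : f (udiag V r) = diag_mx (\row_k r k).
  by rewrite /f /udiag !mulmxA VV mul1mx -mulmxA VV mulmx1.
move=> /(congr1 f); rewrite [LHS]fE [RHS]fE => /matrixP st k.
by have := st k k; rewrite !mxE eqxx !mulr1n.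
Qed.

(** A unitary matrix is normal, hence unitarily diagonalisable, and its eigenvalues have modulus
    one. *)
Lemma unitarymx_spectral d (U : 'M[R[i]]_d) : U \is unitarymx ->
  exists (V : 'M[R[i]]_d) (t : 'I_d -> R), [/\ V \is unitarymx,
    forall k, - pi < t k <= pi & U = udiag V (fun k => cis (t k))].
Proof.
move=> uU; have /unitarymxP UU := uU.
have /orthomx_spectralP UE : U \is normalmx.
  by apply/normalmxP; rewrite UU (mulmx1C UU).
have uV := spectral_unitarymx U; set V := spectralmx U in UE uV.
pose s k := spectral_diag U 0 k.
have {}UE : U = udiag V s.
  rewrite [LHS]UE (invmx_unitary uV) /udiag.
  by rewrite (_ : \row_k s k = spectral_diag U)//; apply/rowP => k; rewrite mxE.
have s1 k : normc (s k) = 1.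
  (* The identity $UU^\dagger=1$, compared on the diagonal, gives $|s_k|^2=1$. *)
  have /(udiag_inj uV)/(_ k) : udiag V (fun k => s k * (s k)^*) = udiag V (fun=> 1).
    by rewrite -(udiagM _ _ uV) -udiag_adj -UE UU udiag1.
  rewrite -sqr_normc -normc_normr -rmorphXn /= => /complexI ?.
  by apply/eqP; rewrite -(eqrXn2 (n := 2)) ?normc_ge0// expr1n; apply/eqP.
have /choice[t ts] k : exists t : R, - pi < t <= pi /\ cis t = s k.
  by have [t ? ?] := cis_surj (s1 k); exists t.
exists V, t; split=> [//|k|]; first by have [] := ts k.
by rewrite UE; apply: eq_udiag => k; have [] := ts k.
Qed.

(** [is_principal_log] controls only eigenvalues; this converts that control into a norm bound. The
    rows of [V] are the required eigenvectors, nonzero because $VV^\dagger$ has ones on its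
    diagonal. *)
Lemma opnorm_herm_le d (A : 'M[R[i]]_d) (c : R) : 0 <= c -> A \is hermsymmx ->
  (forall t : R, eigenvalue A t%:C -> `|t| <= c) -> opnorm A <= c.
Proof.
move=> c0 /hermsymmx_spectral[V [t [uV AE]]] Ac; rewrite AE /hdiag.
apply: udiag_opnorm_le => // k; rewrite /= expr0n addr0 sqrtr_sqr; apply: Ac.
have /unitarymxP VV := uV.
apply/eigenvalueP; exists (row k V).
  rewrite AE -row_mul /hdiag /udiag !mulmxA VV mul1mx mul_diag_mx.
  by apply/rowP => j; rewrite !mxE.
apply/eqP => rV0; have /matrixP/(_ k k)/eqP := VV.
rewrite !mxE eqxx big1 ?(eq_sym 0) ?oner_eq0// => j _.
by have /rowP/(_ j) := rV0; rewrite !mxE => ->; rewrite mul0r.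
Qed.

(** Exhibiting one principal logarithm shows that [xget] does not return its default value; the
    angles of [unitarymx_spectral] supply it. *)
Lemma principal_logP d (U : 'M[R[i]]_d) : U \is unitarymx ->
  is_principal_log U (principal_log U).
Proof.
move=> /unitarymx_spectral[V [t [uV tpi UE]]].
rewrite /principal_log; case: xgetP => [H -> //|] /(_ (hdiag V t)) [].
split; first exact: hermsymmx_hdiag.
  by rewrite (expi_hdiag _ uV).
move=> a /eigenvalueP[v vA v0].
have /unitarymxP VV := uV.
(* In the eigenbasis some coordinate of [v] is nonzero, and comparing it on both sides of the
   eigenvalue equation identifies [a] with [t k]. *)
have [k] : exists k, (v *m V ^t*) 0 k != 0.
  apply/existsP; rewrite -[[exists _, _]]negbK negb_exists; apply/negP => /forallP vV.
  move/eqP: v0; apply; rewrite -[v]mulmx1 -(mulmx1C VV) mulmxA.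
  rewrite (_ : v *m _ = 0) ?mul0mx//.
  by apply/rowP => k; rewrite [RHS]mxE; apply/eqP; rewrite -[_ == _]negbK vV.
set w := v *m _ => wk.
have : w *m diag_mx (\row_k (t k)%:C) = a%:C *: w.
  rewrite /w scalemxAl -vA /hdiag /udiag !mulmxA.
  by rewrite -[RHS]mulmxA VV mulmx1.
clearbody w => /rowP/(_ k); rewrite mul_mx_diag !mxE mulrC => E.
by have /complexI <- := mulIf wk E.
Qed.

(** A traceless principal logarithm qualifies itself. Otherwise the last clause of [is_su_log] is
    vacuous, and determinant one makes the angle sum a multiple of $2\pi$, which [shift_angles]
    removes. *)
Lemma su_logP d (U : 'M[R[i]]_d) : SU U -> is_su_log U (su_log U).
Proof.
move=> [uU dU]; rewrite /su_log; case: xgetP => [H -> //|] noH; exfalso.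
have pi0 := pi_gt0 R.
have [hL eL LU] := principal_logP uU.
have [trL|trL] := eqVneq (\tr (principal_log U)) 0.
  apply: (noH (principal_log U)); split=> //.
  apply: opnorm_herm_le => // [|t /LU/andP[]]; first by rewrite mulr_ge0 ?ltW.
  by rewrite ler_norml; lra.
have [V [t [uV tpi UE]]] := unitarymx_spectral uU.
have tb k : `|t k| <= 2 * pi.
  by have /andP[] := tpi k; rewrite ler_norml; lra.
have ts : cis (\sum_k t k) = 1 by rewrite cis_sum -(udiag_det _ uV) -UE.
have [u [ub us ut]] := shift_angles tb ts.
apply: (noH (hdiag V u)); split.
- split; first exact: hermsymmx_hdiag.
  by rewrite (hdiag_tr _ uV) us.
- by rewrite (expi_hdiag _ uV) UE; exact: eq_udiag.
- apply: (udiag_opnorm_le uV) => [|k]; first by rewrite mulr_ge0 ?ltW.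
  by rewrite /= expr0n addr0 sqrtr_sqr.
- by move=> /eqP; rewrite (negPf trL).
Qed.

End SuLogarithm.

(** * The constants $\mu$ and $h_{\max}$ of a basis, and rounding of coordinates *)

Section BasisConstants.
Local Open Scope classical_set_scope.
Local Open Scope complex_scope.
Context {R : realType}.
Local Notation normc := Normc.normc.

Lemma coord_le_mx_norm m (a : 'rV[R]_m) j : `|a 0 j| <= `|a|.
Proof.
rewrite [leRHS]mx_normrE.
exact: (le_bigmax 0 (fun ij : 'I_1 * 'I_m => `|a ij.1 ij.2|) (0, j)).
Qed.

Lemma mx_norm_le_sum m (a : 'rV[R]_m) : `|a| <= \sum_j `|a 0 j|.
Proof.
rewrite [leLHS]mx_normrE; apply: bigmax_le => [|[i j] _].
  by rewrite sumr_ge0.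
by rewrite ord1 (bigD1 j)//= lerDl sumr_ge0.
Qed.

Lemma ReIm_le_normc (z : R[i]) :
  `|complex.Re z| <= normc z /\ `|complex.Im z| <= normc z.
Proof.
case: z => a b /=; rewrite -!sqrtr_sqr.
by split; apply: ler_wsqrtr; rewrite ?lerDl ?lerDr sqr_ge0.
Qed.

Lemma rlincombE d m (H : 'I_m -> 'M[R[i]]_d) a i j :
  rlincomb H a i j = (\sum_k a 0 k * complex.Re (H k i j))
                  +i* (\sum_k a 0 k * complex.Im (H k i j)).
Proof.
rewrite summxE; elim/big_ind3: _ => // [_ x1 x2 _ y1 y2 -> -> //|k _].
by rewrite mxE; case: (H k i j) => x y; simpc.
Qed.

(* The real coordinates of the matrices [H j] form a row-free real matrix, whose
   pseudo-inverse recovers [a] from the entries of [rlincomb H a]. *)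
Lemma rlincomb_coercive d m (H : 'I_m -> 'M[R[i]]_d) :
  (forall a : 'rV[R]_m, rlincomb H a = 0 -> a = 0) ->
  exists2 c : R, 0 < c & forall a, `|a| <= c * opnorm (rlincomb H a).
Proof.
move=> freeH.
pose B1 := \matrix_k mxvec (\matrix_(i, j) complex.Re (H k i j)).
pose B2 := \matrix_k mxvec (\matrix_(i, j) complex.Im (H k i j)).
pose B : 'M[R]_(m, d * d + d * d) := row_mx B1 B2.
have B1E (a : 'rV_m) i j :
    (a *m B1) 0 (mxvec_index i j) = complex.Re (rlincomb H a i j).
  rewrite rlincombE mxE; apply: eq_bigr => k _.
  by rewrite mxE mxvecE mxE.
have B2E (a : 'rV_m) i j :
    (a *m B2) 0 (mxvec_index i j) = complex.Im (rlincomb H a i j).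
  rewrite rlincombE mxE; apply: eq_bigr => k _.
  by rewrite mxE mxvecE mxE.
have freeB : row_free B.
  rewrite -kermx_eq0; apply/eqP/row_matrixP => k; rewrite row0; apply: freeH.
  have : row k (kermx B) *m B = 0 by rewrite -row_mul mulmx_ker row0.
  move: (row k _) => a; rewrite mul_mx_row -row_mx0 => /eq_row_mx[a1 a2].
  apply/matrixP => i j; rewrite [RHS]mxE; apply/eqP; rewrite eq_complex.
  by rewrite -B1E -B2E a1 a2 !mxE eqxx.
pose c := \sum_j \sum_l `|pinvmx B l j|.
(* The added [1] gives strict positivity: [c] is an empty sum when [m] is [0]. *)
exists (c + 1) => [|a]; first by rewrite ltr_wpDl// sumr_ge0// => j _; rewrite sumr_ge0.
have aB l : `|(a *m B) 0 l| <= opnorm (rlincomb H a).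
  rewrite mul_mx_row; case: (split_ordP l) => {}l ->.
    rewrite row_mxEl; case/mxvec_indexP: l => i j; rewrite B1E.
    exact: le_trans (ReIm_le_normc _).1 (normc_le_opnorm _ _ _).
  rewrite row_mxEr; case/mxvec_indexP: l => i j; rewrite B2E.
  exact: le_trans (ReIm_le_normc _).2 (normc_le_opnorm _ _ _).
apply: (le_trans (mx_norm_le_sum a)).
apply: (@le_trans _ _ (c * opnorm (rlincomb H a))); last first.
  by rewrite ler_wpM2r ?opnorm_ge0// lerDl.
rewrite mulr_suml ler_sum// => j _.
rewrite -{1}(mulmxKp freeB a) mxE (le_trans (ler_norm_sum _ _ _))//.
rewrite mulr_suml ler_sum// => l _; rewrite normrM mulrC.
by rewrite ler_wpM2l.
Qed.

Lemma basis_mu_le d m (H : 'I_m -> 'M[R[i]]_d) (a : 'rV[R]_m) :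
  basis_mu H * `|a| <= opnorm (rlincomb H a).
Proof.
have [->|a0] := eqVneq a 0; first by rewrite normr0 mulr0 opnorm_ge0.
rewrite -ler_pdivlMr ?normr_gt0//; apply: ge_inf; last by exists a.
by exists 0 => _ [b _ <-]; rewrite divr_ge0 ?opnorm_ge0.
Qed.

Lemma delta_mx_neq0 m (j : 'I_m) : delta_mx 0 j != 0 :> 'rV[R]_m.
Proof. by apply/eqP => /rowP/(_ j)/eqP; rewrite !mxE !eqxx oner_eq0. Qed.

(** Coercivity bounds every ratio below by [c^-1]; [0 < m] provides a nonzero vector, so the infimum
    is over a nonempty set. *)
Lemma basis_mu_gt0 d m (H : 'I_m -> 'M[R[i]]_d) : (0 < m)%N ->
  (forall a : 'rV[R]_m, rlincomb H a = 0 -> a = 0) -> 0 < basis_mu H.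
Proof.
move=> m0 /rlincomb_coercive[c c0 Hc]; apply: (@lt_le_trans _ _ c^-1).
  by rewrite invr_gt0.
apply: lb_le_inf.
  pose e : 'rV[R]_m := delta_mx 0 (Ordinal m0).
  by exists (opnorm (rlincomb H e) / `|e|), e => //=; exact: delta_mx_neq0.
move=> _ [a /= a0 <-].
by rewrite ler_pdivlMr ?normr_gt0// ler_pdivrMl.
Qed.

Lemma opnorm_le_basis_hmax d m (H : 'I_m -> 'M[R[i]]_d) j :
  opnorm (H j) <= basis_hmax H.
Proof. exact: (le_bigmax 0 (fun j => opnorm (H j))). Qed.

Lemma basis_hmax_gt0 d m (H : 'I_m -> 'M[R[i]]_d) : (0 < m)%N ->
  (forall a : 'rV[R]_m, rlincomb H a = 0 -> a = 0) -> 0 < basis_hmax H.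
Proof.
move=> m0 freeH; pose j := Ordinal m0.
apply: lt_le_trans (opnorm_le_basis_hmax H j).
have -> : H j = rlincomb H (delta_mx 0 j).
  rewrite /rlincomb (bigD1 j)//= big1 => [|k kj].
    by rewrite mxE !eqxx scale1r addr0.
  by rewrite mxE (negPf kj) andbF scale0r.
apply: lt_le_trans (basis_mu_le _ _).
by rewrite mulr_gt0 ?basis_mu_gt0// normr_gt0 delta_mx_neq0.
Qed.

Lemma nearest_int_dist (a : R) (c : int) : is_nearest_int a c -> `|a - c%:~R| <= 2^-1.
Proof.
move=> ac; have /andP[k1 k2] := floor_itv (a + 2^-1).
apply: (le_trans (ac (Num.floor (a + 2^-1)))).
by rewrite ler_norml; move: k1 k2; rewrite intrD => k1 k2; lra.
Qed.

(** Comparison with the integer [0]. Unlike $|a|+\frac12$, this bound is proportional to $|a|$, so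
    the steps shrink like $1/n$. *)
Lemma nearest_int_norm (a : R) (c : int) : is_nearest_int a c -> `|c%:~R : R| <= 2 * `|a|.
Proof.
move=> /(_ 0); rewrite subr0 => ac.
rewrite -[c%:~R](subrK a) (le_trans (ler_normD _ _))//.
by rewrite distrC; lra.
Qed.

End BasisConstants.

(** * Error analysis of the discrete trotterization *)

Section TrotterError.
Local Open Scope complex_scope.
Context {R : realType}.

(** The factor $\frac12$ cancels the [2] of [opnorm_bracket], and enlarging $i<j$ to all pairs gives
    the square of $\sum_j\|X_j\|$. *)
Lemma opnorm_bracket_sum d r (X : 'I_r -> 'M[R[i]]_d) (delta : R) :
  \sum_j opnorm (X j) <= delta ->
  opnorm (2^-1 *: \sum_(i < r) \sum_(j < r | (i < j)%N) su_bracket (X i) (X j))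
    <= delta ^+ 2.
Proof.
move=> Xd; have half : Normc.normc (2^-1 : R[i]) = 2^-1.
  apply: (@complexI R); rewrite normc_normr ger0_norm ?invr_ge0 ?ler0n//.
  by rewrite fmorphV rmorph_nat.
have s0 : 0 <= \sum_j opnorm (X j) by apply: sumr_ge0 => j _; exact: opnorm_ge0.
apply: (@le_trans _ _ ((\sum_j opnorm (X j)) ^+ 2)); last first.
  by rewrite ler_pXn2r// nnegrE (le_trans s0).
rewrite opnormZ half ler_pdivrMl// expr2 mulr_suml mulr_sumr.
apply: (le_trans (opnorm_sum _ _)); apply: ler_sum => i _.
apply: (le_trans (opnorm_sum _ _)); rewrite !mulr_sumr big_mkcond.
apply: ler_sum => j _; case: ifP => _; first exact: opnorm_bracket.
by rewrite !mulr_ge0 ?opnorm_ge0.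
Qed.

(** The commutator term costs $\delta^2$, and the cubic remainder is absorbed through $C\delta^3\le
    C\delta_0\delta^2$. *)
Lemma BCH_first_order (delta0 C : R) : BCH_estimate delta0 C -> 0 <= C ->
  forall d r (X : 'I_r -> 'M[R[i]]_d) (delta : R), (2 <= d)%N ->
  (forall j, su (X j)) ->
  \sum_j opnorm (X j) <= delta -> delta <= delta0 ->
  opnorm (su_log (\prod_j expi (X j)) - \sum_j X j)
    <= (1 + C * delta0) * delta ^+ 2.
Proof.
move=> hBCH C0 d r X delta d2 suX Xd dd0.
have := hBCH d r X delta d2 suX Xd dd0.
have := opnorm_bracket_sum Xd.
have d0 : 0 <= delta.
  by apply: le_trans Xd; apply: sumr_ge0 => j _; exact: opnorm_ge0.
move: (su_log _) (\sum_j X j) (2^-1 *: _) => L S B hB hL.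
have -> : L - S = (L - (S + B)) + B by rewrite opprD addrA subrK.
apply: (le_trans (opnormD _ _)).
rewrite mulrDl mul1r addrC; apply: lerD; first exact: hB.
apply: (le_trans hL).
by rewrite exprS mulrA ler_wpM2r ?exprn_ge0// ler_wpM2l.
Qed.

Lemma rlincombB d m (H : 'I_m -> 'M[R[i]]_d) (a : 'rV[R]_m) (c : 'I_m -> int) :
  \sum_j ((c j)%:~R : R)%:C *: H j - rlincomb H a =
  \sum_j ((c j)%:~R - a 0 j)%:C *: H j.
Proof.
rewrite /rlincomb -sumrB; apply: eq_bigr => j _.
by rewrite -scalerBl -rmorphB.
Qed.

(** [U] is the [n]-th power of [expi (L / n)], so the Lipschitz bounds for powers and for [expi]
    combine into a comparison of logarithms. *)
Lemma opnorm_expi_root d n (L F U X : 'M[R[i]]_d) :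
  (0 < n)%N -> su L -> su F -> expi L = U -> expi F = X ->
  opnorm (X ^+ n - U) <= n%:R * opnorm (F - (n%:R^-1)%:C *: L).
Proof.
move=> n0 [hL _] [hF _] <- <-.
have hLn := hermsymmxZ (n%:R^-1) hL.
have -> : expi L = expi ((n%:R^-1)%:C *: L) ^+ n.
  rewrite -(expi_natmul _ hLn) scalerA -real_complexM.
  have -> : n%:R / n%:R = 1 :> R by rewrite divff// pnatr_eq0 -lt0n.
  by rewrite scale1r.
apply: (le_trans (opnorm_subrX_unitary _ (expi_unitary hF) (expi_unitary hLn))).
by apply: ler_wpM2l; [exact: ler0n|exact: opnorm_expiB].
Qed.

Lemma trotter_step_size (K eps M n muN : R) :
  0 < K -> 0 < eps -> 0 < n -> 0 < muN ->
  pi ^+ 2 * M ^+ 2 * K / (eps * muN ^+ 2) <= n ->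
  n * (4 * pi * M / (n * muN)) ^+ 2 <= 16 * eps / K.
Proof.
move=> K0 e0 n0 mu0.
rewrite ler_pdivrMr ?mulr_gt0 ?exprn_gt0// => h.
have -> : n * (4 * pi * M / (n * muN)) ^+ 2 =
    16 * (pi ^+ 2 * M ^+ 2) / (n * muN ^+ 2).
  by field; rewrite !gt_eqF.
rewrite ler_pdivrMr ?mulr_gt0 ?exprn_gt0//.
have -> : 16 * eps / K * (n * muN ^+ 2) = 16 * (n * (eps * muN ^+ 2) / K) by ring.
by rewrite ler_wpM2l// ler_pdivlMr.
Qed.

(** The two summands of [K] serve two purposes: $K\ge16/\delta_0$ keeps the total step size within
    the range of the BCH estimate, and $K\ge32(1+C\delta_0)$ makes the accumulated BCH error at most
    [eps / 2]. *)
Lemma trotter_output_bound (delta0 C K : R) :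
  0 < delta0 -> 0 <= C -> BCH_estimate delta0 C ->
  K = 16 * (delta0^-1 + 2 * (1 + C * delta0)) ->
  forall d m : nat, (2 <= d)%N -> (0 < m)%N ->
  forall (G H : 'I_m -> 'M[R[i]]_d), is_exp_basis G H ->
  forall eps : R, 0 < eps -> eps <= delta0 ->
  forall n : nat, (0 < n)%N ->
    pi ^+ 2 * m%:R ^+ 2 * K / (eps * basis_muN H ^+ 2) <= n%:R ->
  forall U Un : 'M[R[i]]_d, SU U -> trotter_output G H n U Un ->
    basis_hmax H <= eps / (n%:R * m%:R) ->
    opnorm (Un - U) <= eps.
Proof.
move=> d0 C0 hBCH KE d m d2 m0 G H [[suH freeH _] GE _] eps e0 ed n n0 hn U Un suU.
move=> [a [c [aE ca ->]]] hmaxle.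
have D0 : 0 < 1 + C * delta0 by rewrite ltr_pwDl// mulr_ge0// ltW.
have K0 : 0 < K by rewrite KE mulr_gt0// addr_gt0 ?invr_gt0 ?mulr_gt0.
have [suL eL nL _] := su_logP suU.
have n0' : 0 < n%:R :> R by rewrite ltr0n.
have m0' : 0 < m%:R :> R by rewrite ltr0n.
have mu0 := basis_mu_gt0 m0 freeH.
have hm0 := basis_hmax_gt0 m0 freeH.
have muN0 : 0 < basis_muN H by rewrite divr_gt0.
(* Here $\mu\|\alpha\|_\infty\le\|L/n\|\le2\pi/n$, where [L] is [su_log U]. *)
have alpha : `|a| <= 2 * pi / (n%:R * basis_mu H).
  rewrite ler_pdivlMr ?mulr_gt0// mulrC -mulrA -ler_pdivlMl//.
  apply: (le_trans (basis_mu_le H a)); rewrite -aE opnormZr.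
  by rewrite ger0_norm ?invr_ge0 ?(ltW n0')// ler_wpM2l ?invr_ge0 ?(ltW n0').
pose X j := ((c j)%:~R : R)%:C *: H j.
have suX j : su (X j) by exact: suZ.
pose delta := 4 * pi * m%:R / (n%:R * basis_muN H).
have Xdelta : \sum_j opnorm (X j) <= delta.
  apply: (@le_trans _ _ (\sum_(j < m) 2 * (2 * pi / (n%:R * basis_mu H)) * basis_hmax H)).
    apply: ler_sum => j _; rewrite opnormZr; apply: ler_pM => //.
    - exact: opnorm_ge0.
    - apply: (le_trans (nearest_int_norm (ca j))); rewrite ler_wpM2l//.
      exact: le_trans (coord_le_mx_norm a j) alpha.
    - exact: opnorm_le_basis_hmax.
  rewrite sumr_const card_ord -mulr_natr /delta /basis_muN le_eqVlt; apply/orP; left.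
  by apply/eqP; field; rewrite !gt_eqF.
have step := trotter_step_size K0 e0 n0' muN0 hn.
rewrite -/delta in step.
have n1 : 1 <= n%:R :> R by rewrite ler1n.
have sK : 16 / K <= delta0.
  rewrite ler_pdivrMr// KE mulrCA mulrDr divff ?gt_eqF// -[leLHS]mulr1 ler_wpM2l//.
  by rewrite lerDl !mulr_ge0 ?(ltW d0) ?(ltW D0).
have delta_ge0 : 0 <= delta.
  by apply/ltW/(divr_gt0 (mulr_gt0 (mulr_gt0 _ (pi_gt0 R)) m0') (mulr_gt0 n0' muN0)).
(* Squares are compared: $\delta^2\le
   n\delta^2\le16\varepsilon/K\le\delta_0\varepsilon\le\delta_0^2$. *)
have dd0 : delta <= delta0.
  rewrite -(ler_pXn2r (n := 2)) ?nnegrE// ?(ltW d0)//.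
  apply: (@le_trans _ _ (n%:R * delta ^+ 2)); first by rewrite ler_peMl ?sqr_ge0.
  apply: (le_trans step); rewrite mulrAC expr2; apply: ler_pM => //.
  - by rewrite divr_ge0 ?(ltW K0).
  - exact: ltW.
have prodE : \prod_j gpow (G j) (c j) = \prod_j expi (X j).
  by apply: eq_bigr => j _; rewrite GE gpow_expi//; case: (suH j).
(* Membership in [SU] ensures that [su_log] of the product really exponentiates back to it. *)
have SUP : SU (\prod_j expi (X j)) by apply: SU_prod => j; exact: expi_su.
have [suF eF _ _] := su_logP SUP.
rewrite prodE; apply: (le_trans (opnorm_expi_root n0 suL suF eL eF)).
rewrite aE; have := BCH_first_order hBCH C0 d2 suX Xdelta dd0.
move: (su_log (\prod_j _)) => F hF.
have -> : F - rlincomb H a = (F - \sum_j X j) + (\sum_j X j - rlincomb H a).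
  by rewrite addrA subrK.
(* Rounding error: each of the [m] coordinates is off by at most $\frac12$, on a matrix of norm at
   most $h_{\max}$; after the factor [n] this totals [eps / 2]. *)
have hR : opnorm (\sum_j X j - rlincomb H a)
    <= m%:R * (2^-1 * (eps / (n%:R * m%:R))).
  rewrite rlincombB; apply: (le_trans (opnorm_sum _ _)).
  apply: (@le_trans _ _ (\sum_(j < m) 2^-1 * (eps / (n%:R * m%:R)))); last first.
    by rewrite sumr_const card_ord -[leLHS]mulr_natl.
  apply: ler_sum => j _; rewrite opnormZr; apply: ler_pM => //.
  - exact: opnorm_ge0.
  - by rewrite distrC; exact: nearest_int_dist.
  - exact: le_trans (opnorm_le_basis_hmax H j) hmaxle.
apply: (@le_trans _ _ (n%:R * ((1 + C * delta0) * delta ^+ 2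
     + m%:R * (2^-1 * (eps / (n%:R * m%:R)))))).
  apply: ler_wpM2l; first exact: ltW.
  by apply: (le_trans (opnormD _ _)); exact: lerD.
have -> : n%:R * ((1 + C * delta0) * delta ^+ 2 + m%:R * (2^-1 * (eps / (n%:R * m%:R))))
    = (1 + C * delta0) * (n%:R * delta ^+ 2) + eps / 2.
  by field; rewrite !gt_eqF.
rewrite [leRHS]splitr lerD2r.
apply: (le_trans (ler_wpM2l (ltW D0) step)).
have -> : (1 + C * delta0) * (16 * eps / K) =
    eps * (16 * (1 + C * delta0)) / K by ring.
(* What remains is $16(1+C\delta_0)\le K/2$, and $K/2$ exceeds the left side by $8/\delta_0$. *)
rewrite ler_pdivrMr// -mulrA ler_wpM2l ?(ltW e0)// KE.
have -> : 2^-1 * (16 * (delta0^-1 + 2 * (1 + C * delta0))) =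
    8 * delta0^-1 + 16 * (1 + C * delta0) by field; rewrite gt_eqF.
by rewrite lerDr mulr_ge0// invr_ge0 ltW.
Qed.

End TrotterError.

Theorem proposition4p8 (R : realType) (delta0 C : R)
    (hdelta0 : 0 < delta0) (hdelta0_pi : delta0 < pi) (hC : 1 <= C)
    (hBCH : BCH_estimate delta0 C) :
  exists K : R, 0 < K /\
    forall (d : nat), (2 <= d)%N ->
    let M := (d ^ 2 - 1)%N in
    forall (G H : 'I_M -> 'M[R[i]]_d), is_exp_basis G H ->
    forall eps0 : R, 0 < eps0 -> eps0 <= delta0 ->
    forall n : nat, (0 < n)%N ->
      pi ^+ 2 * M%:R ^+ 2 * K / (eps0 * basis_muN H ^+ 2) <= n%:R ->
    forall U Un : 'M[R[i]]_d, SU U -> trotter_output G H n U Un ->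
      basis_hmax H <= eps0 / (n%:R * M%:R) ->
      opnorm (Un - U) <= eps0.
Proof.
have C0 : 0 <= C by exact: le_trans hC.
(* [K] depends on [delta0] and [C] alone, so it is fixed before the dimension and the basis. *)
exists (16 * (delta0^-1 + 2 * (1 + C * delta0))); split.
  by rewrite mulr_gt0// addr_gt0 ?invr_gt0// mulr_gt0// ltr_pwDl// mulr_ge0// ltW.
move=> d d2 M; apply: (trotter_output_bound hdelta0 C0 hBCH erefl d2).
(* From $d\ge2$ follows $d^2\ge d>1$, so the basis is nonempty. *)
by rewrite /M subn_gt0 (leq_trans _ (leq_pexp2l (ltnW d2) (leqnSn 1))).
Qed.
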